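(* Let $\{S_j:j\in\mathscr J\}$ be a non-empty family of Hausdorff semitopological semigroups, each algebraically a primitive inverse semigroup, such that for each $j\in\mathscr J$ the space $S_j$ is either semiregular and pseudocompact or countably compact, and every maximal subgroup of $S_j$ (with the subspace topology) is a pseudocompact paratopological group. Then the direct product $\prod_{j\in\mathscr J}S_j$ with the Tychonoff product topology is a pseudocompact semitopological inverse semigroup.
   Context: A semitopological semigroup is a Hausdorff space with separately continuous associative operation; a paratopological group is a group with Hausdorff topology and jointly continuous multiplication. A semigroup is inverse if every $x$ has a unique $y$ with $xyx=x$, $yxy=y$; primitive inverse if it is non-trivial, inverse, has a zero and all non-zero idempotents are minimal among non-zero idempotents. Pseudocompact: every locally finite family of non-empty open sets is finite; semiregular: having a base of regular open sets. *)

(* Defs.v *)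
From Stdlib Require Import List.
Set Implicit Arguments.

Definition set (X : Type) := X -> Prop.

Definition is_topology (X : Type) (op : set (set X)) : Prop :=
  op (fun _ => True) /\
  (forall U V, op U -> op V -> op (fun x => U x /\ V x)) /\
  (forall F : set (set X), (forall U, F U -> op U) ->
     op (fun x => exists U, F U /\ U x)).

Definition hausdorff (X : Type) (op : set (set X)) : Prop :=
  forall x y, x <> y -> exists U V, op U /\ op V /\ U x /\ V y /\
    forall z, ~ (U z /\ V z).

Definition continuous (X Y : Type) (opX : set (set X)) (opY : set (set Y))
  (f : X -> Y) : Prop :=
  forall U, opY U -> opX (fun x => U (f x)).

Definition sub_open (X : Type) (op : set (set X)) (P : set X) : set (set {x | P x}) :=
  fun V => exists U, op U /\ forall z : {x | P x}, V z <-> U (proj1_sig z).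

Definition prod_open (J : Type) (S : J -> Type) (op : forall j, set (set (S j)))
  : set (set (forall j, S j)) :=
  fun W => forall x, W x -> exists (l : list J) (V : forall j, set (S j)),
     (forall j, op j (V j)) /\ (forall j, V j (x j)) /\
     (forall y, (forall j, In j l -> V j (y j)) -> W y).

Definition interior (X : Type) (op : set (set X)) (A : set X) : set X :=
  fun x => exists U, op U /\ U x /\ forall y, U y -> A y.
Definition closure (X : Type) (op : set (set X)) (A : set X) : set X :=
  fun x => forall U, op U -> U x -> exists y, U y /\ A y.
Definition regular_open (X : Type) (op : set (set X)) (V : set X) : Prop :=
  op V /\ forall x, V x <-> interior op (closure op V) x.
Definition semiregular (X : Type) (op : set (set X)) : Prop :=
  forall U x, op U -> U x -> exists V, regular_open op V /\ V x /\ forall y, V y -> U y.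

Definition finite_family (X : Type) (F : set (set X)) : Prop :=
  exists l : list (set X), forall A, F A -> In A l.
Definition locally_finite (X : Type) (op : set (set X)) (F : set (set X)) : Prop :=
  forall x, exists W, op W /\ W x /\
    finite_family (fun A => F A /\ exists y, W y /\ A y).
Definition pseudocompact (X : Type) (op : set (set X)) : Prop :=
  forall F : set (set X),
    (forall A, F A -> op A /\ exists x, A x) ->
    locally_finite op F -> finite_family F.

Definition countably_compact (X : Type) (op : set (set X)) : Prop :=
  forall U : nat -> set X, (forall n, op (U n)) -> (forall x, exists n, U n x) ->
    exists N, forall x, exists n, n < N /\ U n x.

Definition associative (S : Type) (m : S -> S -> S) : Prop :=
  forall x y z, m x (m y z) = m (m x y) z.

Definition semitopological_semigroup (S : Type) (op : set (set S)) (m : S -> S -> S) : Prop :=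
  is_topology op /\ hausdorff op /\ associative m /\
  (forall a, continuous op op (fun x => m a x)) /\
  (forall a, continuous op op (fun x => m x a)).

Definition inverse_semigroup (S : Type) (m : S -> S -> S) : Prop :=
  associative m /\
  forall x, exists! y, m (m x y) x = x /\ m (m y x) y = y.

Definition idempotent (S : Type) (m : S -> S -> S) (e : S) : Prop := m e e = e.

Definition is_zero (S : Type) (m : S -> S -> S) (z : S) : Prop :=
  forall x, m z x = z /\ m x z = z.

Definition primitive_inverse_semigroup (S : Type) (m : S -> S -> S) : Prop :=
  inverse_semigroup m /\
  exists z, is_zero m z /\ (exists x, x <> z) /\
    forall e f, idempotent m e -> idempotent m f -> e <> z -> f <> z ->
      m e f = f -> m f e = f -> f = e.

Definition subgroup (S : Type) (m : S -> S -> S) (G : set S) : Prop :=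
  (forall x y, G x -> G y -> G (m x y)) /\
  exists e, G e /\ idempotent m e /\
    forall x, G x -> m e x = x /\ m x e = x /\
      exists y, G y /\ m x y = e /\ m y x = e.

Definition maximal_subgroup (S : Type) (m : S -> S -> S) (G : set S) : Prop :=
  subgroup m G /\
  forall H, subgroup m H -> (forall x, G x -> H x) -> forall x, H x -> G x.

(* G (a subgroup of S), with the subspace topology, is a paratopological group:
   Hausdorff (inherited) and multiplication G x G -> G jointly continuous
   (stated pointwise with respect to subspace and product topologies). *)
Definition paratopological_subgroup (S : Type) (op : set (set S)) (m : S -> S -> S)
  (G : set S) : Prop :=
  subgroup m G /\ hausdorff (sub_open op G) /\
  forall x y, G x -> G y -> forall W, op W -> W (m x y) ->
    exists U V, op U /\ op V /\ U x /\ V y /\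
      forall a b, G a -> G b -> U a -> V b -> W (m a b).

(* Main.v *)
(* A sequence of open sets converges along a free ultrafilter p on nat to x if every
   neighbourhood of x meets p-almost all of them. Spaces in which all sequences of non-empty
   open sets so converge are pseudocompact and, for a fixed p, closed under products, so it
   suffices to find limits in each factor.

   In a primitive inverse semigroup S the sets H(e,f) = {x | x x^-1 = e, x^-1 x = f}, for
   non-zero idempotents e and f, are open, partition S minus its zero, and are right
   translates of the maximal subgroup H(e,e). Pseudocompactness of S forces the closure of
   each neighbourhood of zero to contain all but finitely many of them, so a sequence of open
   sets either converges to zero or p-often meets a single H(e,f), and the question reduces
   to maximal subgroups.

   In a pseudocompact paratopological group the closures of the neighbourhoods of 1 are a
   neighbourhood base at 1 of a precompact group topology. Given open sets U_n around points
   x_n, precompactness and pseudocompactness yield a limit of the x_n for a countable family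
   of these closures adapted to the U_n, and pseudocompactness makes it a limit of the U_n. *)

Require Import Defs.
From Stdlib Require Import List.
From Stdlib Require Import ClassicalEpsilon FunctionalExtensionality.
From Stdlib Require Import PropExtensionality ProofIrrelevance Arith Lia.
From Corelib Require Import ssreflect.
From mathcomp Require ssrnat filter.
Set Implicit Arguments.
Unset Strict Implicit.

(** * Extensionality, choice principles and sequences built by recursion *)

Lemma set_ext (X : Type) (A B : set X) : (forall x, A x <-> B x) -> A = B.
Proof.
by move=> AB; apply: functional_extensionality => x; apply: propositional_extensionality.
Qed.

Lemma choose_family (I : Type) (T : I -> Type) (P : forall i, T i -> Prop) :
  (forall i, exists x, P i x) -> exists f : forall i, T i, forall i, P i (f i).
Proof.
move=> h.
by exists (fun i => proj1_sig (constructive_indefinite_description _ (h i))) => i;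
  case: constructive_indefinite_description.
Qed.

Lemma dependent_choices (T : Type) (P : T -> Prop) (R : nat -> T -> T -> Prop) (x0 : T) :
  (forall n x, P x -> exists y, P y /\ R n x y) -> P x0 ->
  exists s : nat -> T, forall n, P (s n) /\ R n (s n) (s (S n)).
Proof.
move=> step Px0.
have total n x : exists y, P x -> P y /\ R n x y.
  case: (classic (P x)) => [/(step n)[y ?]|?]; first by exists y.
  by exists x.
have [f fP] := choose_family (fun n => choose_family (total n)).
pose s := fix s n := match n with 0 => x0 | S k => f k (s k) end.
have Ps n : P (s n) by elim: n => // n /(fP n) [].
by exists s => n; split=> //; have [] := fP n (s n) (Ps n).
Qed.

(** Passing the earlier terms to [Q] as a list allows each new term to be chosen away from all of
    them. *)
Lemma list_choices (T : Type) (Q : list T -> T -> Prop) :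
  (forall l, exists x, Q l x) ->
  exists z : nat -> T, forall n, exists l, Q l (z n) /\ forall i, i < n -> In (z i) l.
Proof.
move=> QE.
have [f fQ] := choose_family QE.
pose s := fix s n := match n with 0 => nil | S k => f (s k) :: s k end.
exists (fun n => f (s n)) => n; exists (s n); split=> //.
elim: n => [|n IHn] i lt_in /=; first by lia.
by case: (Nat.eq_dec i n) => [->|?]; [left | right; apply: IHn; lia].
Qed.

Lemma eventually_avoids_list (T : Type) (u : nat -> T) (l : list T) :
  (forall x, In x l -> exists N, forall n, N <= n -> u n <> x) ->
  exists N, forall n, N <= n -> ~ In (u n) l.
Proof.
elim: l => [|x l IHl] h; first by exists 0 => n _ [].
have [|N NP] := IHl; first by move=> y yl; apply: h; right.
have [M MP] := h x (or_introl eq_refl).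
exists (N + M) => n le_n [E|].
  by apply: (MP n) => //; lia.
by apply: NP; lia.
Qed.

(** * Pseudocompactness through cluster points of sequences of open sets *)

Definition meets (X : Type) (A B : set X) : Prop := exists x, A x /\ B x.

Definition has_cluster_points (X : Type) (op : set (set X)) : Prop :=
  forall U : nat -> set X, (forall n, op (U n)) -> (forall n, exists x, U n x) ->
  exists x, forall W, op W -> W x -> forall N, exists n, N <= n /\ meets (U n) W.

(** Without a cluster point the range of [U] is a locally finite family, hence finite. A family
    forgets repetitions, so it remains to see that each value is taken only finitely often, which is
    absurd for a sequence with finite range. *)
Lemma pseudocompact_cluster (X : Type) (op : set (set X)) :
  pseudocompact op -> has_cluster_points op.
Proof.
move=> pc U Uop Une; apply: NNPP => noc.
have nocx x : exists W, op W /\ W x /\ exists N, forall n, N <= n -> ~ meets (U n) W.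
  apply: NNPP => h; apply: noc; exists x => W Wop Wx N.
  apply: NNPP => h'; apply: h; exists W; split=> //; split=> //; exists N => n Nn UW.
  by apply: h'; exists n.
have [||l lP] := pc (fun A => exists n, A = U n).
- by move=> _ [n ->].
- move=> x; have [W [Wop [Wx [N NP]]]] := nocx x; exists W; split=> //; split=> //.
  exists (map U (seq 0 N)) => _ [[n ->] [y [Wy Uy]]].
  case: (le_lt_dec N n) => [/NP []|lt_nN]; first by exists y.
  by apply: in_map; apply/in_seq; lia.
have [|N NP] := @eventually_avoids_list _ U l.
  move=> A _; case: (classic (exists x, A x)) => [[x Ax]|Ae]; last first.
    by exists 0 => n _ UA; apply: Ae; rewrite -UA.
  have [W [_ [Wx [N NP]]]] := nocx x; exists N => n Nn UA.
  by apply: (NP n Nn); exists x; rewrite UA.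
by apply: (NP N (le_n N)); apply: lP; exists N.
Qed.

(** An infinite family contains an injective sequence, and every neighbourhood of a cluster point of
    it meets infinitely many members. *)
Lemma cluster_pseudocompact (X : Type) (op : set (set X)) :
  has_cluster_points op -> pseudocompact op.
Proof.
move=> cp F Fop lf; apply: NNPP => infF.
have more l : exists A, F A /\ ~ In A l.
  apply: NNPP => h; apply: infF; exists l => A FA.
  by apply: NNPP => Al; apply: h; exists A.
have [z zP] := list_choices more.
have Fz n : F (z n) by have [l [[]]] := zP n.
have zinj i n : i < n -> z i <> z n.
  move=> lt_in E; have [l [[_ nl] li]] := zP n.
  by apply: nl; rewrite -E; apply: li.
have [||x xP] := cp z.
- by move=> n; have [] := Fop _ (Fz n).
- by move=> n; have [] := Fop _ (Fz n).
have [W [Wop [Wx [l lP]]]] := lf x.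
have [|N NP] := @eventually_avoids_list _ z l.
  move=> A _; case: (classic (exists n, z n = A)) => [[n <-]|h].
    by exists (S n) => k nk E; apply: (zinj n k) => //; rewrite E.
  by exists 0 => n _ E; apply: h; exists n.
have [n [Nn [y [zy Wy]]]] := xP W Wop Wx N.
by apply: (NP n Nn); apply: lP; split=> //; exists y.
Qed.

Lemma open_of_nbhds (X : Type) (op : set (set X)) (A : set X) :
  is_topology op -> (forall x, A x -> exists U, op U /\ U x /\ forall y, U y -> A y) -> op A.
Proof.
move=> [_ [_ opU]] h.
have -> : A = fun x => exists U, (op U /\ forall y, U y -> A y) /\ U x.
  apply: set_ext => x; split=> [/h[U [? [? ?]]]|[U [[_ UA] Ux]]]; last exact: UA.
  by exists U.
by apply: opU => U [].
Qed.

(** Without a cluster point the open sets [C N] cover the space, but those of index below [N]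
    contain no point of [U N]. *)
Lemma countably_compact_pseudocompact (X : Type) (op : set (set X)) :
  is_topology op -> countably_compact op -> pseudocompact op.
Proof.
move=> top cc; apply: cluster_pseudocompact => U Uop Une; apply: NNPP => noc.
pose C N x := exists W, op W /\ W x /\ forall n, N <= n -> ~ meets (U n) W.
have [||N NP] := cc C.
- move=> N; apply: open_of_nbhds => // x [W [? [? h]]].
  by exists W; do 2!split=> //; move=> y Wy; exists W.
- move=> x; apply: NNPP => h; apply: noc; exists x => W Wop Wx N.
  apply: NNPP => h'; apply: h; exists N, W; split=> //; split=> // n Nn UW.
  by apply: h'; exists n.
have [x Ux] := Une N; have [i [lt_iN [W [_ [Wx h]]]]] := NP x.
by apply: (h N); [lia | exists x].
Qed.

(** * Free ultrafilters on [nat] and limits along them *)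

Record free_ultrafilter (p : set (set nat)) : Prop := {
  ultra_sub : forall A B : set nat, p A -> (forall n, A n -> B n) -> p B;
  ultra_cap : forall A B : set nat, p A -> p B -> p (fun n => A n /\ B n);
  ultra_dec : forall A : set nat, p A \/ p (fun n => ~ A n);
  ultra_unbounded : forall A : set nat, p A -> forall N, exists n, N <= n /\ A n }.

(** An ultrafilter refining the filter of tails contains every tail; as it omits the empty set, each
    member meets every tail. *)
Lemma free_ultrafilter_exists : exists p, free_ultrafilter p.
Proof.
have [p [pu sub]] := @filter.ultraFilterLemma _ _ filter.eventually_filter.
have pf := @filter.filter_filter _ _ (@filter.ultra_proper _ _ pu).
exists p; split.
- by move=> A B pA AB; apply: (@filter.filterS _ _ pf A B).
- by move=> A B; apply: filter.filterI.
- by move=> A; exact: (@filter.in_ultra_setVsetC _ p A pu).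
- move=> A pA N; apply: NNPP => h.
  apply: (@filter.filter_not_empty _ p (@filter.ultra_proper _ _ pu)).
  have pN : p (fun n => is_true (ssrnat.leq N n)).
    by apply: sub; exists N => // n.
  apply: (@filter.filterS _ _ pf _ _ _ (filter.filterI pA pN)) => n [An Nn].
  by apply: h; exists n; split=> //; exact: (ssrbool.elimT ssrnat.leP Nn).
Qed.

Lemma ultra_list_ex (p : set (set nat)) (T : Type) (l : list T) (Q : T -> nat -> Prop) :
  free_ultrafilter p -> p (fun n => exists x, In x l /\ Q x n) ->
  exists x, In x l /\ p (Q x).
Proof.
move=> pu; elim: l => [|x l IHl] h.
  by have [n [_ [x [[]]]]] := ultra_unbounded pu h 0.
case: (ultra_dec pu (Q x)) => [?|h']; first by exists x; split=> //; left.
have [|y [yl Qy]] := IHl; last by exists y; split=> //; right.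
by apply: (ultra_sub pu (ultra_cap pu h h')) => n [[y [[->|yl] Qy]] nQ]; last by exists y.
Qed.

Lemma ultra_list_all (p : set (set nat)) (T : Type) (l : list T) (Q : T -> nat -> Prop) :
  free_ultrafilter p -> (forall x, p (Q x)) -> p (fun n => forall x, In x l -> Q x n).
Proof.
move=> pu Qp; elim: l => [|x l IHl].
  case: (ultra_dec pu (fun _ => True)) => [h|/(ultra_unbounded pu)/(_ 0)[n [_ []]]//].
  by apply: (ultra_sub pu h) => n _ x [].
apply: (ultra_sub pu (ultra_cap pu (Qp x) IHl)) => n [Qx Ql] y [<-//|].
exact: Ql.
Qed.

(* Unlike pseudocompactness, the existence of limits of sequences of open sets along one
   fixed free ultrafilter passes to arbitrary products. *)
Definition ultra_pseudocompact (p : set (set nat)) (X : Type) (op : set (set X)) : Prop :=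
  forall U : nat -> set X, (forall n, op (U n)) -> (forall n, exists x, U n x) ->
  exists x, forall W, op W -> W x -> p (fun n => meets (U n) W).

Lemma ultra_pseudocompact_pseudocompact (p : set (set nat)) (X : Type) (op : set (set X)) :
  free_ultrafilter p -> ultra_pseudocompact p op -> pseudocompact op.
Proof.
move=> pu up; apply: cluster_pseudocompact => U Uop Une.
have [x xP] := up U Uop Une; exists x => W Wop Wx.
exact: (ultra_unbounded pu (xP W Wop Wx)).
Qed.

(** Each [U n] is shrunk to a box and limits are taken coordinatewise. A basic neighbourhood
    constrains finitely many coordinates, and [p] is closed under finite intersections; at the other
    coordinates [x n] supplies the common point. *)
Lemma ultra_pseudocompact_prod (p : set (set nat)) (J : Type) (S : J -> Type)
  (op : forall j, set (set (S j))) :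
  free_ultrafilter p -> (forall j, ultra_pseudocompact p (op j)) ->
  ultra_pseudocompact p (prod_open S op).
Proof.
move=> pu up U Uop Une.
have [x Ux] := choose_family Une.
have box n : exists V : forall j, set (S j), (forall j, op j (V j)) /\
    (forall j, V j (x n j)) /\
    exists l, forall y, (forall j, In j l -> V j (y j)) -> U n y.
  have [l [V [? [? ?]]]] := Uop n (x n) (Ux n).
  by exists V; do 2!split=> //; exists l.
have [V VP] := choose_family box.
have lim j : exists y, forall W, op j W -> W y -> p (fun n => meets (V n j) W).
  apply: up => n; have [Vop [Vx _]] := VP n; first exact: Vop.
  by exists (x n j).
have [y yP] := choose_family lim.
exists y => W Wop Wy.
have [l' [V' [V'op [V'y V'W]]]] := Wop y Wy.
have := @ultra_list_all p J l' (fun j n => meets (V n j) (V' j)) pu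
  (fun j => yP j _ (V'op j) (V'y j)).
move/(ultra_sub pu); apply=> n mV.
have [Vop [Vx [l lU]]] := VP n.
have coord j : exists t, V n j t /\ (In j l' -> V' j t).
  case: (classic (In j l')) => [/mV[t [? ?]]|?]; first by exists t.
  by exists (x n j).
have [w wP] := choose_family coord.
exists w; split; first by apply: lU => j _; have [] := wP j.
by apply: V'W => j jl; have [_] := wP j; apply.
Qed.

(** * Pseudocompact paratopological groups *)

Section PseudocompactParatopologicalGroup.

Variables (G : Type) (op : set (set G)) (mul : G -> G -> G) (e : G) (inv : G -> G).

Local Notation "x * y" := (mul x y).
Local Notation "x ^-" := (inv x) (at level 3, left associativity, format "x ^-").

Hypothesis top : is_topology op.
Hypothesis mulA : forall x y z, x * (y * z) = (x * y) * z.
Hypothesis mul1g : forall x, e * x = x.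
Hypothesis mulVg : forall x, x^- * x = e.
Hypothesis mulgV : forall x, x * x^- = e.
Hypothesis mul_continuous : forall x y W, op W -> W (x * y) ->
  exists U V, op U /\ op V /\ U x /\ V y /\ forall a b, U a -> V b -> W (a * b).
Hypothesis pcG : pseudocompact op.

Let clusterG : has_cluster_points op := pseudocompact_cluster pcG.

Lemma mulKg x y : x^- * (x * y) = y.
Proof. by rewrite mulA mulVg mul1g. Qed.

Lemma mulKVg x y : x * (x^- * y) = y.
Proof. by rewrite mulA mulgV mul1g. Qed.

Lemma mulg1 x : x * e = x.
Proof. by rewrite -(mulVg x) mulKVg. Qed.

Lemma invg_unique x y : x * y = e -> y = x^-.
Proof. by move=> xy; rewrite -(mulKg x y) xy mulg1. Qed.

Lemma invgK x : x^-^- = x.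
Proof. by rewrite -(@invg_unique x^- x). Qed.

Lemma invMg x y : (x * y)^- = y^- * x^-.
Proof. by rewrite -(@invg_unique (x * y) (y^- * x^-)) // -mulA mulKVg mulgV. Qed.

Let gsimp := (mulKg, mulKVg, mulVg, mulgV, mul1g, mulg1, invMg, invgK).
Ltac gnorm := rewrite ?invMg ?invgK -?mulA ?gsimp.

Lemma open_left_translate a U : op U -> op (fun x => U (a * x)).
Proof.
move=> Uop; apply: open_of_nbhds => // x Ux.
have [A [B [_ [Bop [Aa [Bx AB]]]]]] := mul_continuous Uop Ux.
by exists B; do 2!split=> //; move=> y; apply: AB.
Qed.

Lemma open_right_translate a U : op U -> op (fun x => U (x * a)).
Proof.
move=> Uop; apply: open_of_nbhds => // x Ux.
have [A [B [Aop [_ [Ax [Ba AB]]]]]] := mul_continuous Uop Ux.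
by exists A; do 2!split=> //; move=> y Ay; apply: AB.
Qed.

Lemma open_cap U V : op U -> op V -> op (fun x => U x /\ V x).
Proof. by case: top => _ [+ _]; apply. Qed.

Lemma closure_sub (A B : set G) : (forall x, A x -> B x) ->
  forall x, closure op A x -> closure op B x.
Proof. by move=> AB x clx O Oop Ox; have [y [? /AB ?]] := clx O Oop Ox; exists y. Qed.

Lemma closure_incl (A : set G) x : A x -> closure op A x.
Proof. by move=> Ax O _ Ox; exists x. Qed.

(** Translations suffice: [x] is moved into [A] with [y] fixed, then [y] into [B]. *)
Lemma closure_mul (A B C : set G) : (forall x y, A x -> B y -> C (x * y)) ->
  forall x y, closure op A x -> closure op B y -> closure op C (x * y).
Proof.
move=> ABC x y clx cly O Oop Oxy.
have [a [Oay Aa]] := clx _ (open_right_translate y Oop) Oxy.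
have [b [Oab Bb]] := cly _ (open_left_translate a Oop) Oay.
by exists (a * b); split=> //; apply: ABC.
Qed.

Lemma open_square_root U : op U -> U e ->
  exists V, op V /\ V e /\ forall x y, V x -> V y -> U (x * y).
Proof.
move=> Uop Ue; have Uee : U (e * e) by rewrite mul1g.
have [A [B [Aop [Bop [Ae [Be AB]]]]]] := mul_continuous Uop Uee.
by exists (fun x => A x /\ B x); split; [exact: open_cap | split=> // x y [? _] [_ ?]; apply: AB].
Qed.

(* If every non-empty open P contained non-empty open P' and R with R disjoint from P'V,
   iterating would give disjoint pairs R_n and P_(n+1)V with R_(n+1) inside P_(n+1), and
   bV would miss every R_n for a cluster point b of the R_n. *)
Lemma locally_dense_translates V : op V -> V e ->
  exists P, op P /\ (exists g, P g) /\ forall P' R, op P' -> op R ->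
    (exists x, P' x /\ P x) -> (exists x, R x /\ P x) ->
    exists x v, P' x /\ V v /\ R (x * v).
Proof.
move=> Vop Ve; apply: NNPP => none.
pose ok (PR : set G * set G) := op (fst PR) /\ exists x, fst PR x.
pose next (n : nat) (PR QR : set G * set G) :=
  (forall x, fst QR x -> fst PR x) /\ op (snd QR) /\ (exists x, snd QR x) /\
  (forall x, snd QR x -> fst PR x) /\
  forall x v, fst QR x -> V v -> ~ snd QR (x * v).
have [||s sP] := @dependent_choices _ ok next (fun _ => True, fun _ => True).
- move=> n [P R] [/= Pop Pne]; apply: NNPP => h; apply: none; exists P; do 2!split=> //.
  move=> P' R' P'op R'op [x [P'x Px]] [y [R'y Py]]; apply: NNPP => h'; apply: h.
  exists (fun z => P' z /\ P z, fun z => R' z /\ P z); split.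
    by split; [exact: open_cap | exists x].
  split=> [z [] //|]; split; first exact: open_cap.
  split; first by exists y.
  split=> [z []//|z v [P'z _] Vv [R'zv _]].
  by apply: h'; exists z, v.
- by split; [case: top | exists e].
have decr n k : n <= k -> forall x, fst (s k) x -> fst (s n) x.
  move=> le_nk; elim: k / le_nk => [//|k _ IHk] x Px; apply: IHk.
  by have [_ [+ _]] := sP k; apply.
have [||b bP] := @clusterG (fun n => snd (s (S n))).
- by move=> n; have [_ [_ []]] := sP n.
- by move=> n; have [_ [_ [_ []]]] := sP n.
have Vb : V (b^- * b) by rewrite mulVg.
have [n [_ [x [Rx Vx]]]] := bP _ (open_left_translate b^- Vop) Vb 0.
have Rb : snd (s (S n)) (b * (b^- * x)) by rewrite mulKVg.
have [_ [_ [Rop [_ [_ avoid]]]]] := sP n.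
have [k [lt_nk [y [Ry Ryv]]]] := bP _ (open_right_translate _ Rop) Rb (S n).
apply: (avoid y _ _ Vx Ryv); apply: (decr _ _ lt_nk).
by have [_ [_ [_ [_ [+ _]]]]] := sP k; apply.
Qed.

(** Inversion is continuous at [e] up to closure. For [P], [g] from [locally_dense_translates] and
    [O] around [x^-], the translates of [V] and [O] by [g * x] meet [P] at [g * x] and at [g], so
    [O] meets [V V]. *)
Lemma inv_in_closure U : op U -> U e ->
  exists P, op P /\ P e /\ forall x, P x -> closure op U x^-.
Proof.
move=> Uop Ue; have [V [Vop [Ve VV]]] := open_square_root Uop Ue.
have [P [Pop [[g Pg] dense]]] := locally_dense_translates Vop Ve.
exists (fun x => P (g * x)); split; first exact: open_left_translate.
split; first by rewrite mulg1.
move=> x Pgx O Oop Ox.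
have [||||y [v [Vy [Vv Oyv]]]] :=
  dense (fun y => V (x^- * g^- * y)) (fun y => O (x^- * g^- * y)).
- exact: open_left_translate.
- exact: open_left_translate.
- by exists (g * x); split=> //; gnorm.
- by exists g; split=> //; gnorm.
by exists (x^- * g^- * (y * v)); split=> //; rewrite mulA; apply: VV.
Qed.

(* The closures of the open neighbourhoods of e form a base at e of a coarser group
   topology, the semiregularization of [op]. *)
Definition regular_nbhd (A : set G) : Prop :=
  exists U, op U /\ U e /\ forall x, closure op U x -> A x.

Lemma regular_nbhd_interior A : regular_nbhd A ->
  exists U, op U /\ U e /\ forall x, U x -> A x.
Proof. by move=> [U [? [? UA]]]; exists U; do 2!split=> //; move=> x /closure_incl/UA. Qed.

Lemma regular_nbhd1 A : regular_nbhd A -> A e.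
Proof. by move/regular_nbhd_interior=> [U [_ [Ue]]]; apply. Qed.

Lemma regular_nbhd_cap A B : regular_nbhd A -> regular_nbhd B ->
  regular_nbhd (fun x => A x /\ B x).
Proof.
move=> [U [Uop [Ue UA]]] [V [Vop [Ve VB]]].
exists (fun x => U x /\ V x); split; first exact: open_cap.
by split=> // x clx; split; [apply: UA | apply: VB]; apply: closure_sub clx => y [].
Qed.

Lemma regular_nbhd_square_root A : regular_nbhd A ->
  exists B, regular_nbhd B /\ forall x y, B x -> B y -> A (x * y).
Proof.
move=> [U [Uop [Ue UA]]]; have [V [Vop [Ve VV]]] := open_square_root Uop Ue.
exists (closure op V); split; first by exists V.
by move=> x y Vx Vy; apply: UA; apply: closure_mul Vx Vy.
Qed.

(** If [x] is in the closure of [P], then [x V] contains some [y] in [P], and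
    [x^- = (x^- * y) * y^-] is a product of a point of [V] and one of the closure of [V]. *)
Lemma regular_nbhd_inv A : regular_nbhd A -> regular_nbhd (fun x => A x^-).
Proof.
move=> [U [Uop [Ue UA]]]; have [V [Vop [Ve VV]]] := open_square_root Uop Ue.
have [P [Pop [Pe PV]]] := inv_in_closure Vop Ve.
exists (fun x => P x /\ V x); split; first exact: open_cap.
split=> // x clx; apply: UA.
have Vx : V (x^- * x) by rewrite mulVg.
have [y [Vxy [Py _]]] := clx _ (open_left_translate x^- Vop) Vx.
have -> : x^- = (x^- * y) * y^- by gnorm.
exact: (@closure_mul V V U VV _ _ (@closure_incl V _ Vxy) (PV y Py)).
Qed.

Definition symmetric (A : set G) : Prop := forall x, A x -> A x^-.

Lemma regular_nbhd_cube_root A : regular_nbhd A -> exists B, regular_nbhd B /\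
  symmetric B /\ forall x y z, B x -> B y -> B z -> A (x * y * z).
Proof.
move=> nA; have [B [nB BB]] := regular_nbhd_square_root nA.
have [C [nC CC]] := regular_nbhd_square_root nB.
exists (fun x => C x /\ C x^-); split.
  by apply: regular_nbhd_cap; last exact: regular_nbhd_inv.
split=> [x [? ?]|x y z [Cx _] [Cy _] [Cz _]]; first by rewrite invgK.
apply: BB; first exact: CC.
by rewrite -(mulg1 z); apply: CC => //; exact: regular_nbhd1.
Qed.

Lemma regular_nbhd_fourth_root A : regular_nbhd A -> exists B, regular_nbhd B /\
  symmetric B /\ forall x y z t, B x -> B y -> B z -> B t -> A (x * y * z * t).
Proof.
move=> nA; have [B [nB [symB BB]]] := regular_nbhd_cube_root nA.
have [C [nC [symC CC]]] := regular_nbhd_cube_root nB.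
exists C; do 2!split=> //; move=> x y z t Cx Cy Cz Ct.
rewrite -(mulg1 (x * y * z * t)) -(mulA _ z t).
have -> : x * y * (z * t) * e = (x * y * e) * (z * t * e) * e by rewrite !mulg1.
have Be := regular_nbhd1 nB; have Ce := regular_nbhd1 nC.
by apply: BB => //; apply: CC.
Qed.

(** Otherwise some sequence has [z n] outside [z i A] for all [i < n]. Two of the sets [z n U] meet
    the same small neighbourhood of a cluster point, which puts some [(z i)^- * z n] in a fourfold
    product of [B]. *)
Lemma precompact A : regular_nbhd A ->
  exists l : list G, forall x, exists g, In g l /\ A (g^- * x).
Proof.
move=> nA; apply: NNPP => h.
have more l : exists x, forall g, In g l -> ~ A (g^- * x).
  apply: NNPP => h'; apply: h; exists l => x; apply: NNPP => h''; apply: h'.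
  by exists x => g gl Agx; apply: h''; exists g.
have [z zP] := list_choices more.
have [B [nB [symB BA]]] := regular_nbhd_fourth_root nA.
have [U [Uop [Ue UB]]] := regular_nbhd_interior nB.
have [||y yP] := @clusterG (fun n x => U ((z n)^- * x)).
- by move=> n; exact: open_left_translate.
- by move=> n; exists (z n); rewrite mulVg.
have Uy : U (y^- * y) by rewrite mulVg.
have {}yP := yP _ (open_left_translate y^- Uop) Uy.
have [i [_ [s [/UB zs /UB ys]]]] := yP 0.
have [n [lt_in [t [/UB zt /UB yt]]]] := yP (S i).
have [l [lP li]] := zP n.
apply: (lP (z i)); first exact: li.
have -> : (z i)^- * z n = ((z i)^- * s) * (y^- * s)^- * (y^- * t) * ((z n)^- * t)^-.
  by gnorm.
by apply: BA => //; apply: symB.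
Qed.

Variable p : set (set nat).
Hypothesis pu : free_ultrafilter p.

(** Precompactness puts [p]-almost all [x n] in one translate of [A k] by some [g k]. A cluster
    point [y] of these translates works: for some [k > m] the [k]-th one meets [y A (S m)], and a
    threefold product of [A (S m)] lies in [A m]. *)
Lemma ultra_cauchy_limit (A : nat -> set G) (x : nat -> G) :
  (forall n, regular_nbhd (A n)) -> (forall n, symmetric (A n)) ->
  (forall n a b c, A (S n) a -> A (S n) b -> A (S n) c -> A n (a * b * c)) ->
  (forall m n, m <= n -> forall a, A n a -> A m a) ->
  exists y, forall k, p (fun n => A k (y^- * x n)).
Proof.
move=> nA symA cubeA decrA.
have center k : exists g, p (fun n => A k (g^- * x n)).
  have [l lP] := precompact (nA k).
  have all : p (fun n => exists g, In g l /\ A k (g^- * x n)).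
    case: (ultra_dec pu (fun n => exists g, In g l /\ A k (g^- * x n))) => //.
    by move/(ultra_unbounded pu)/(_ 0)=> [n [_ []]].
  by have [g [_ ?]] := ultra_list_ex pu all; exists g.
have [g gP] := choose_family center.
have [U UP] := choose_family (fun k => regular_nbhd_interior (nA k)).
have [||y yP] := @clusterG (fun k t => U k ((g k)^- * t)).
- by move=> k; apply: open_left_translate; have [] := UP k.
- by move=> k; exists (g k); rewrite mulVg; have [_ []] := UP k.
exists y => m; have [Uop [Ue UA]] := UP (S m).
have Uy : U (S m) (y^- * y) by rewrite mulVg.
have [k [lt_mk [t [Ut /UA yt]]]] := yP _ (open_left_translate y^- Uop) Uy (S m).
have {}Ut : A k ((g k)^- * t) by have [_ [_]] := UP k; apply.
apply: (ultra_sub pu (gP k)) => n Agx.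
have -> : y^- * x n = (y^- * t) * ((g k)^- * t)^- * ((g k)^- * x n) by gnorm.
by apply: cubeA => //; apply: (decrA _ k) => //; apply: symA.
Qed.

(* If O were an open neighbourhood of the limit 1 of the points u_n disjoint from the sets
   u_n A_n^4, then along a subsequence the translates u_k A_k would have no cluster point:
   a neighbourhood C z meeting the k-th and the l-th of them puts a point of u_k A_k^3 in
   C C^-1. *)
Theorem paratopological_group_ultra_pseudocompact : ultra_pseudocompact p op.
Proof.
move=> U Uop Une.
have [x Ux] := choose_family Une.
pose E n v := U n (x n * v).
have nE n : regular_nbhd (closure op (E n)).
  exists (E n); split; first exact: open_left_translate.
  by split=> //; rewrite /E mulg1.
pose next n (A B : set G) := symmetric B /\
  (forall a b c, B a -> B b -> B c -> A (a * b * c)) /\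
  (forall a b c d, B a -> B b -> B c -> B d -> closure op (E n) (a * b * c * d)).
have [||s sP] := @dependent_choices _ regular_nbhd next (fun _ => True).
- move=> n A nA; have [B [nB [symB BA]]] := regular_nbhd_cube_root nA.
  have [C [nC [symC CE]]] := regular_nbhd_fourth_root (nE n).
  exists (fun a => B a /\ C a); split; first exact: regular_nbhd_cap.
  split; first by move=> a [? ?]; split; [apply: symB | apply: symC].
  by split=> [a b c [? _] [? _] [? _]|a b c d [_ ?] [_ ?] [_ ?] [_ ?]]; [apply: BA | apply: CE].
- by exists (fun _ => True); case: top.
(* The shift discards [s 0], for which [next] gives neither symmetry nor a bound by some [E n]. *)
pose A n := s (S n).
have nA n : regular_nbhd (A n) by have [] := sP (S n).
have symA n : symmetric (A n) by have [_ []] := sP n.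
have cubeA n a b c : A (S n) a -> A (S n) b -> A (S n) c -> A n (a * b * c).
  by have [_ [_ [+ _]]] := sP (S n); apply.
have fourthA n a b c d : A n a -> A n b -> A n c -> A n d ->
    closure op (E n) (a * b * c * d).
  by have [_ [_ [_]]] := sP n; apply.
have decrA m n : m <= n -> forall a, A n a -> A m a.
  move=> le_mn; elim: n / le_mn => [//|n _ IHn] a Aa; apply: IHn.
  by rewrite -(mulg1 a) -(mulg1 (a * e)); apply: cubeA => //; exact: regular_nbhd1.
have [y yP] := @ultra_cauchy_limit A x nA symA cubeA decrA.
exists y => O Oop Oy; case: (ultra_dec pu (fun n => meets (U n) O)) => // far.
pose u n := y^- * x n.
have nO : regular_nbhd (closure op (fun w => O (y * w))).
  exists (fun w => O (y * w)); split; first exact: open_left_translate.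
  by split=> //; rewrite mulg1.
have [C [nC [symC CO]]] := regular_nbhd_cube_root nO.
have [D [Dop [De DC]]] := regular_nbhd_interior nC.
have Ce := regular_nbhd1 nC.
have [n0 [_ n0P]] := ultra_unbounded pu far 0.
have [||k kP] := @dependent_choices _ (fun n => ~ meets (U n) O)
    (fun _ n n' => n < n' /\ A n (u n')) n0 => //.
  move=> i n _; have [n' [? [? ?]]] := ultra_unbounded pu (ultra_cap pu far (yP n)) (S n).
  by exists n'.
have kincr i j : i <= j -> k i <= k j.
  move=> le_ij; elim: j / le_ij => [//|j _ IHj]; have [_ [? _]] := kP j; lia.
have [V VP] := choose_family (fun n => regular_nbhd_interior (nA n)).
have [||z zP] := @clusterG (fun i t => V (k i) ((u (k i))^- * t)).
- by move=> i; apply: open_left_translate; have [] := VP (k i).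
- by move=> i; exists (u (k i)); rewrite mulVg; have [_ []] := VP (k i).
have Dz : D (z * z^-) by rewrite mulgV.
have {}zP := zP _ (open_right_translate z^- Dop) Dz.
have [i [_ [a [Va /DC Ca]]]] := zP 0.
have [j [lt_ij [b [Vb /DC Cb]]]] := zP (S i).
have {}Va : A (k i) ((u (k i))^- * a) by have [_ [_]] := VP (k i); apply.
have {}Vb : A (k i) ((u (k j))^- * b).
  by apply: (decrA _ (k j)); [apply: kincr; lia | have [_ [_]] := VP (k j); apply].
have Au : A (k i) (u (k j)).
  (* As [j > i], it is a successor, and [u (k j)] was chosen in [A] at the preceding index of the
     subsequence. *)
  case: j lt_ij {b Cb Vb} => [|j] lt_ij; first by lia.
  by apply: (decrA _ (k j)); [apply: kincr; lia | have [_ [_]] := kP j].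
have clO : closure op (fun w => O (y * w)) (a * b^-).
  have -> : a * b^- = (a * z^-) * (b * z^-)^- * e by gnorm.
  by apply: CO => //; apply: symC.
have [Vop [Ve VA]] := VP (k i).
have Vab : V (k i) ((a * b^-)^- * (a * b^-)) by rewrite mulVg.
(* Moving [a * b^-] from the closure to a point [w] with [O (y * w)] costs the fourth factor from
   [A (k i)]. *)
have [w [/VA Aw Ow]] := clO _ (open_left_translate (a * b^-)^- Vop) Vab.
have clE : closure op (E (k i)) ((u (k i))^- * w).
  have -> : (u (k i))^- * w =
    ((u (k i))^- * a) * ((u (k j))^- * b)^- * (u (k j))^- * ((a * b^-)^- * w) by gnorm.
  by apply: fourthA => //; apply: symA.
have Ouw : O (x (k i) * ((u (k i))^- * w)) by rewrite /u; gnorm.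
have [v [Ov Ev]] := clE _ (open_left_translate (x (k i)) Oop) Ouw.
by have [[]] := kP i; exists (x (k i) * v).
Qed.

End PseudocompactParatopologicalGroup.

(** * Idempotents of inverse semigroups *)

Section InverseSemigroup.

Variables (S : Type) (mul : S -> S -> S).
Local Notation "x * y" := (mul x y).
Hypothesis invS : inverse_semigroup mul.

Let mulA : forall x y z, x * (y * z) = (x * y) * z := proj1 invS.

Definition inverse_of (x y : S) : Prop := x * y * x = x /\ y * x * y = y.

Lemma inverse_exists x : exists y, inverse_of x y.
Proof. by have [y [? _]] := proj2 invS x; exists y. Qed.

Lemma inverse_unique x y y' : inverse_of x y -> inverse_of x y' -> y = y'.
Proof. by have [t [_ tP]] := proj2 invS x; move=> /tP <- /tP <-. Qed.

(** The inverse [x] of [e * f] equals [f * x * e] by uniqueness, hence is idempotent and its own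
    inverse; [e * f] is also an inverse of [x], so the two coincide. *)
Lemma idempotent_mul e f : idempotent mul e -> idempotent mul f -> idempotent mul (e * f).
Proof.
rewrite /idempotent => ee ff; have [x [h1 h2]] := inverse_exists (e * f).
have xE : x = f * x * e.
  apply: (@inverse_unique (e * f)); split=> //.
    have -> : e * f * (f * x * e) * (e * f) = e * (f * f) * x * (e * e) * f by rewrite !mulA.
    by rewrite ee ff; move: h1; rewrite !mulA.
  have -> : f * x * e * (e * f) * (f * x * e) = f * (x * ((e * e) * (f * f)) * x) * e.
    by rewrite !mulA.
  by rewrite ee ff h2.
have xx : x * x = x.
  rewrite {1 2}xE; have -> : f * x * e * (f * x * e) = f * (x * (e * f) * x) * e.
    by rewrite !mulA.
  by rewrite h2.
have -> : e * f = x; last by [].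
by apply: (@inverse_unique x); split; rewrite ?xx.
Qed.

(** Both [e * f], being idempotent, and [f * e] are inverses of [e * f]. *)
Lemma idempotent_comm e f : idempotent mul e -> idempotent mul f -> e * f = f * e.
Proof.
move=> ee ff; have ef := idempotent_mul ee ff; have fe := idempotent_mul ff ee.
move: (ee) (ff) (ef) (fe); rewrite /idempotent => ee' ff' ef' fe'.
apply: (@inverse_unique (e * f)); first by split; rewrite !ef'.
split.
  have -> : e * f * (f * e) * (e * f) = e * (f * f) * (e * e) * f by rewrite !mulA.
  by rewrite ee' ff' -(mulA (e * f)) ef'.
have -> : f * e * (e * f) * (f * e) = f * (e * e) * (f * f) * e by rewrite !mulA.
by rewrite ee' ff' -(mulA (f * e)) fe'.
Qed.

End InverseSemigroup.

(** * Subgroups as topological groups on subtypes *)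

Lemma sub_open_topology (X : Type) (op : set (set X)) (P : set X) :
  is_topology op -> is_topology (sub_open op P).
Proof.
move=> [opT [opI opU]]; split; first by exists (fun _ => True).
split=> [U V [U' [? UU']] [V' [? VV']]|F Fop].
  by exists (fun x => U' x /\ V' x); split; [exact: opI | move=> t; rewrite UU' VV'].
exists (fun x => exists U, (op U /\ exists V, F V /\ forall t, V t <-> U (proj1_sig t)) /\ U x).
split=> [|t]; first by apply: opU => U [].
split=> [[V [FV Vt]]|[U [[_ [V [FV VU]]] Ut]]]; last by exists V; rewrite VU.
have [U [Uop VU]] := Fop V FV; exists U; rewrite -VU; split=> //; split=> //.
by exists V.
Qed.

Lemma sig_eq (X : Type) (P : set X) (s t : {x | P x}) : proj1_sig s = proj1_sig t -> s = t.
Proof. by case: s t => [x Px] [y Py] /= E; apply: subset_eq_compat. Qed.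

Lemma paratopological_subgroup_ultra_pseudocompact (p : set (set nat)) (S : Type)
  (op : set (set S)) (mul : S -> S -> S) (G : set S) :
  free_ultrafilter p -> is_topology op -> associative mul ->
  paratopological_subgroup op mul G -> pseudocompact (sub_open op G) ->
  ultra_pseudocompact p (sub_open op G).
Proof.
move=> pu top mulA [[mulG [e [Ge [ee eP]]]] [_ mulc]] pc.
have invE (x : {x | G x}) : exists y : {x | G x},
    mul (proj1_sig x) (proj1_sig y) = e /\ mul (proj1_sig y) (proj1_sig x) = e.
  case: x => [x Gx]; have [_ [_ [y [Gy ?]]]] := eP x Gx.
  by exists (exist _ y Gy).
have [inv invP] := choose_family invE.
pose mulsig (x y : {x | G x}) : {x | G x} :=
  exist _ (mul (proj1_sig x) (proj1_sig y)) (mulG _ _ (proj2_sig x) (proj2_sig y)).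
apply: (@paratopological_group_ultra_pseudocompact _ _ mulsig (exist _ e Ge) inv) => //.
- exact: sub_open_topology.
- by move=> x y w; apply: sig_eq; exact: mulA.
- by move=> [x Gx]; apply: sig_eq; have [] := eP x Gx.
- by move=> x; apply: sig_eq; have [] := invP x.
- by move=> x; apply: sig_eq; have [] := invP x.
move=> [x Gx] [y Gy] W [W' [W'op WW']] /WW' /= Wxy.
have [U [V [Uop [Vop [Ux [Vy UVW]]]]]] := mulc x y Gx Gy W' W'op Wxy.
exists (fun t => U (proj1_sig t)), (fun t => V (proj1_sig t)).
split; first by exists U.
split; first by exists V.
by do 2!split=> //; move=> [a Ga] [b Gb] /= Ua Vb; apply/WW'; apply: UVW.
Qed.

(** * Primitive inverse semigroups and their classes *)

Section PrimitiveInverseSemigroup.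

Variables (S : Type) (mul : S -> S -> S) (z : S).
Local Notation "x * y" := (mul x y).
Hypothesis invS : inverse_semigroup mul.
Hypothesis zeroS : is_zero mul z.
Hypothesis primS : forall e f, idempotent mul e -> idempotent mul f -> e <> z -> f <> z ->
  e * f = f -> f * e = f -> f = e.

Let mulA : forall x y w, x * (y * w) = (x * y) * w := proj1 invS.
Let mul0 x : z * x = z := proj1 (zeroS x).
Let mulz0 x : x * z = z := proj2 (zeroS x).

(* For non-zero idempotents e and f this is the set of x with x x^-1 = e and x^-1 x = f. *)
Definition hclass (e f : S) : set S := fun x => e * x * f <> z.

Lemma inverse_of_sym x y : inverse_of mul x y -> inverse_of mul y x.
Proof. by case. Qed.

Lemma inverse_of_idempotent x y : inverse_of mul x y -> idempotent mul (x * y).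
Proof. by move=> [xyx _]; rewrite /idempotent mulA xyx. Qed.

(** The product is a non-zero idempotent below both factors, so minimality identifies it with
    each. *)
Lemma primitive_mul_eq e f : idempotent mul e -> idempotent mul f -> e * f <> z -> e = f.
Proof.
move=> ee ff nz.
have en : e <> z by move=> E; apply: nz; rewrite E mul0.
have fn : f <> z by move=> E; apply: nz; rewrite E mulz0.
have ef := idempotent_mul invS ee ff; have C := idempotent_comm invS ee ff.
have <- : e * f = e.
  by apply: primS => //; [rewrite mulA ee | rewrite {1}C -mulA ee C].
by apply: primS => //; [rewrite C mulA ff | rewrite -mulA ff].
Qed.

(** Since [x = x * y * x], a non-zero [e * x * f] makes [e * (x * y)] and [(y * x) * f] non-zero. *)
Lemma hclass_inverse e f x y : idempotent mul e -> idempotent mul f ->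
  inverse_of mul x y -> hclass e f x -> x * y = e /\ y * x = f.
Proof.
move=> ee ff xy; have yx := inverse_of_sym xy; have [xyx _] := xy => exf.
split; [symmetry|]; apply: primitive_mul_eq => //; try exact: inverse_of_idempotent.
  by move=> E; apply: exf; rewrite -xyx !mulA -(mulA e x y) E !mul0.
by move=> E; apply: exf; rewrite -xyx -!mulA (mulA y x f) E !mulz0.
Qed.

Lemma hclass_self x y : x <> z -> inverse_of mul x y -> hclass (x * y) (y * x) x.
Proof. by move=> nz [xyx _]; rewrite /hclass xyx mulA xyx. Qed.

Lemma hclass_unit e f x : idempotent mul e -> idempotent mul f ->
  hclass e f x -> e * x = x /\ x * f = x.
Proof.
move=> ee ff Hx; have [y xy] := inverse_exists invS x.
have [<- <-] := hclass_inverse ee ff xy Hx.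
by have [xyx _] := xy; rewrite mulA.
Qed.

(** A larger subgroup contains the idempotent [e], which must be its identity; a member with
    [e * x * e = z] would then be [z] itself and, being invertible, force [e = z]. *)
Lemma hclass_maximal_subgroup e : idempotent mul e -> e <> z ->
  maximal_subgroup mul (hclass e e).
Proof.
move=> ee nz.
have inv x : hclass e e x -> exists y, hclass e e y /\ x * y = e /\ y * x = e.
  move=> Hx; have [y xy] := inverse_exists invS x.
  have [xye yxe] := hclass_inverse ee ee xy Hx; exists y; split=> //.
  have := @hclass_self y x _ (inverse_of_sym xy); rewrite xye yxe; apply=> E.
  by apply: nz; rewrite -xye E mulz0.
have He : hclass e e e by rewrite /hclass ee ee.
split; first split.
- move=> x y Hx Hy E; have [x' [_ [_ x'x]]] := inv x Hx; have [y' [_ [yy' _]]] := inv y Hy.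
  have [ex _] := hclass_unit ee ee Hx; have [_ ye] := hclass_unit ee ee Hy.
  apply: nz; have <- : e * e = e by [].
  rewrite -{1}x'x -yy' mulA -(mulA x' x y).
  by move: E; rewrite mulA ex -mulA ye => ->; rewrite mulz0 mul0.
- exists e; do 2!split=> //; move=> x Hx; have [? ?] := hclass_unit ee ee Hx.
  by do 2!split=> //; exact: inv.
move=> H [mulH [d [Hd [dd dP]]]] sub x Hx.
have ed : e = d.
  have [de [_ [y [_ [_ ye]]]]] := dP e (sub e He).
  by rewrite -de -ye -mulA ee.
have [ex [xe [y [_ [xy _]]]]] := dP x Hx; rewrite -ed in ex xe xy.
rewrite /hclass ex xe => E; apply: nz; by rewrite -xy E mul0.
Qed.

Variables (op : set (set S)) (p : set (set nat)).
Hypothesis stsS : semitopological_semigroup op mul.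
Hypothesis pcS : pseudocompact op.
Hypothesis pu : free_ultrafilter p.
Hypothesis subgroups : forall G, maximal_subgroup mul G ->
  paratopological_subgroup op mul G /\ pseudocompact (sub_open op G).

Let topS : is_topology op := proj1 stsS.

(** The class is the preimage of the open complement of zero under two translations, so separate
    continuity is enough. *)
Lemma hclass_open e f : op (hclass e f).
Proof.
have [_ [haus [_ [contl contr]]]] := stsS.
have nzop : op (fun x => x <> z).
  apply: open_of_nbhds => // x /haus[U [V [Uop [_ [Ux [Vz UV]]]]]].
  by exists U; do 2!split=> //; move=> y Uy E; apply: (UV y); rewrite {2}E.
exact: (contl e _ (contr f _ nzop)).
Qed.

(** Right multiplication by a point [a] of the class carries [hclass e e] onto it, with
    multiplication by [b] as inverse; the limit is found in the maximal subgroup and carried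
    back. *)
Lemma hclass_ultra_limit (U : nat -> set S) e f : idempotent mul e -> idempotent mul f ->
  (forall n, op (U n)) -> p (fun n => meets (U n) (hclass e f)) ->
  exists x, forall W, op W -> W x -> p (fun n => meets (U n) W).
Proof.
move=> ee ff Uop often.
have [_ [_ [a [_ Ha]]]] := ultra_unbounded pu often 0.
have [b ab] := inverse_exists invS a; have [abe baf] := hclass_inverse ee ff ab Ha.
have enz : e <> z by move=> E; apply: Ha; rewrite E !mul0.
have [para pc] := subgroups (hclass_maximal_subgroup ee enz).
have up := paratopological_subgroup_ultra_pseudocompact pu topS mulA para pc.
have [_ [_ [_ [_ contr]]]] := stsS.
(* Indices whose [U n] misses the class get the whole subgroup, so that no [V n] is empty; they are
   negligible for [p]. *)
pose V n (g : {x | hclass e e x}) := meets (U n) (hclass e f) -> U n (proj1_sig g * a).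
have [||g gP] := up V.
- move=> n; case: (classic (meets (U n) (hclass e f))) => mU.
    exists (fun x => U n (x * a)); split; first exact: contr.
    by move=> g; split; [apply | move=> ? _].
  exists (fun _ => True); split; first by case: topS.
  by move=> g; split=> // _ /mU.
- move=> n; case: (classic (meets (U n) (hclass e f))) => [[x [Ux Hx]]|?]; last first.
    have He : hclass e e e by rewrite /hclass ee ee.
    by exists (exist _ e He).
  have [ex xf] := hclass_unit ee ff Hx.
  have Hxb : hclass e e (x * b).
    rewrite /hclass mulA ex => E; apply: Hx; rewrite /hclass ex -baf.
    have [aba _] := ab; have <- : e * a = a by rewrite -abe.
    by rewrite (mulA b) (mulA x) (mulA x) E mul0.
  by exists (exist _ _ Hxb) => _ /=; rewrite -mulA baf xf.
exists (proj1_sig g * a) => W Wop Wga.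
have open_W : sub_open op (hclass e e) (fun h : {x | hclass e e x} => W (proj1_sig h * a)).
  by exists (fun x => W (x * a)); split=> //; exact: contr.
apply: (ultra_sub pu (ultra_cap pu often (gP _ open_W Wga))) => n [mU [h [Vh Wh]]].
by exists (proj1_sig h * a); split=> //; apply: Vh.
Qed.

(* When the sets U_n do not keep meeting one class H, they converge to zero: for a
   neighbourhood W of zero the sets H \ cl W form a locally finite family, so almost all
   classes H are contained in cl W. *)
Theorem primitive_inverse_ultra_pseudocompact : ultra_pseudocompact p op.
Proof.
move=> U Uop Une.
case: (classic (exists e f, idempotent mul e /\ idempotent mul f /\
  p (fun n => meets (U n) (hclass e f)))) => [[e [f [ee [ff often]]]]|rare].
  exact: (hclass_ultra_limit ee ff Uop often).
exists z => W Wop Wz; case: (ultra_dec pu (fun n => meets (U n) W)) => // away.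
exfalso.
pose ext x := exists V, op V /\ V x /\ ~ meets V W.
have ext_open : op ext.
  apply: open_of_nbhds => // x [V [? [? VW]]].
  by exists V; do 2!split=> //; move=> y Vy; exists V.
pose F A := (exists e f, idempotent mul e /\ idempotent mul f /\
  A = fun x => hclass e f x /\ ext x) /\ exists x, A x.
have [||l lF] := pcS (F := F).
- move=> A [[e [f [_ [_ AE]]]] Ane]; split=> //; rewrite AE.
  by have [_ [opI _]] := topS; apply: opI => //; exact: hclass_open.
(* [W] misses every member of [F], and the class of a non-zero point is a neighbourhood that misses
   all other classes. *)
- move=> x; case: (classic (x = z)) => [->|nz].
    exists W; do 2!split=> //; exists nil => A [[[e [f [_ [_ ->]]]] _] [y [Wy [_ ey]]]].
    by have [V [_ [Vy VW]]] := ey; apply: VW; exists y.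
  have [x' xx'] := inverse_exists invS x.
  exists (hclass (x * x') (x' * x)); split; first exact: hclass_open.
  split; first exact: hclass_self.
  exists (cons (fun y => hclass (x * x') (x' * x) y /\ ext y) nil).
  move=> A [[[e [f [ee [ff AE]]]] _] [y [Hy Ay]]]; left; move: Ay; rewrite AE => [[Hy' _]].
  have [y' yy'] := inverse_exists invS y.
  have [<- <-] := hclass_inverse ee ff yy' Hy'.
  have [-> ->] // := hclass_inverse (inverse_of_idempotent xx')
    (inverse_of_idempotent (inverse_of_sym xx')) yy' Hy.
have some : p (fun n => exists A, In A l /\ (F A /\ meets (U n) A)).
  apply: (ultra_sub pu away) => n nUW; have [x Ux] := Une n.
  have nz : x <> z by move=> E; apply: nUW; exists z; rewrite -{1}E.
  have [x' xx'] := inverse_exists invS x.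
  pose A y := hclass (x * x') (x' * x) y /\ ext y.
  have Ax : A x by split; [exact: hclass_self | exists (U n)].
  have FA : F A.
    split; last by exists x.
    exists (x * x'), (x' * x); split; first exact: inverse_of_idempotent.
    by split=> //; apply: inverse_of_idempotent; exact: inverse_of_sym.
  by exists A; split; [exact: lF | split=> //; exists x].
have [A [_ often]] := ultra_list_ex pu some.
have [_ [_ [[[e [f [ee [ff AE]]]] _] _]]] := ultra_unbounded pu often 0.
apply: rare; exists e, f; do 2!split=> //.
apply: (ultra_sub pu often) => n [_ [x [Ux]]]; rewrite AE => [[Hx _]].
by exists x.
Qed.

End PrimitiveInverseSemigroup.

(** * Tychonoff products of semitopological inverse semigroups *)

Lemma cylinder (J : Type) (S : J -> Type) (op : forall j, set (set (S j))) (j : J)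
  (U : set (S j)) : (forall i, is_topology (op i)) -> op j U ->
  prod_open S op (fun x => U (x j)).
Proof.
move=> top Uop x Ux.
(* Quantifying over proofs of [i = j] yields [U] at [j] and the whole space elsewhere without
   deciding equality on [J]. *)
pose V i (t : S i) := forall E : i = j, U (eq_rect i S t j E).
have VE t : V j t <-> U t.
  split=> [/(_ eq_refl)//|Ut E].
  by rewrite (proof_irrelevance _ E eq_refl).
exists (j :: nil)%list, V; split; last split.
- move=> i; case: (classic (i = j)) => [->|ne]; first by rewrite (set_ext VE).
  have -> : V i = fun _ => True by apply: set_ext => t; split=> // _ E.
  by case: (top i).
- by move=> i E; have -> : eq_rect i S (x i) j E = x j by clear; case: _ / E.
- by move=> y /(_ j (or_introl eq_refl))/VE.
Qed.

Lemma prod_open_topology (J : Type) (S : J -> Type) (op : forall j, set (set (S j))) :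
  (forall j, is_topology (op j)) -> is_topology (prod_open S op).
Proof.
move=> top; split; last split.
- move=> x _; exists nil, (fun _ _ => True); split=> //.
  by move=> j; case: (top j).
- move=> A B Aop Bop x [Ax Bx].
  have [l [V [Vop [Vx VA]]]] := Aop x Ax; have [k [W [Wop [Wx WB]]]] := Bop x Bx.
  exists (l ++ k), (fun j t => V j t /\ W j t); split; last split=> // y VWy.
    by move=> j; have [_ [opI _]] := top j; apply: opI.
  by split; [apply: VA | apply: WB] => j jl; have [] := VWy j; rewrite ?in_app_iff; auto.
- move=> F Fop x [A [FA Ax]]; have [l [V [Vop [Vx VA]]]] := Fop A FA x Ax.
  by exists l, V; do 2!split=> //; move=> y /VA Ay; exists A.
Qed.

Lemma prod_semitopological (J : Type) (S : J -> Type) (op : forall j, set (set (S j)))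
  (m : forall j, S j -> S j -> S j) :
  (forall j, semitopological_semigroup (op j) (m j)) ->
  semitopological_semigroup (prod_open S op) (fun x y j => m j (x j) (y j)).
Proof.
move=> sts; have top j : is_topology (op j) by case: (sts j).
split; first exact: prod_open_topology.
split.
  move=> x y ne; have [j nej] : exists j, x j <> y j.
    apply: NNPP => h; apply: ne; apply: functional_extensionality_dep => j.
    by apply: NNPP => h'; apply: h; exists j.
  have [_ [haus _]] := sts j; have [U [V [Uop [Vop [Ux [Vy UV]]]]]] := haus _ _ nej.
  exists (fun t => U (t j)), (fun t => V (t j)); split; first exact: cylinder.
  by split; first exact: cylinder.
split.
  move=> x y w; apply: functional_extensionality_dep => j.
  by have [_ [_ [mA _]]] := sts j; apply: mA.
split=> a W Wop x Wx; have [l [V [Vop [Vx VW]]]] := Wop _ Wx.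
  exists l, (fun j t => V j (m j (a j) t)); split; last by split=> // y Vy; apply: VW.
  by move=> j; have [_ [_ [_ [cl _]]]] := sts j; apply: cl.
exists l, (fun j t => V j (m j t (a j))); split; last by split=> // y Vy; apply: VW.
by move=> j; have [_ [_ [_ [_ cr]]]] := sts j; apply: cr.
Qed.

Lemma prod_inverse_semigroup (J : Type) (S : J -> Type) (m : forall j, S j -> S j -> S j) :
  (forall j, inverse_semigroup (m j)) ->
  inverse_semigroup (fun (x y : forall j, S j) j => m j (x j) (y j)).
Proof.
move=> inv; split=> [x y w|x].
  by apply: functional_extensionality_dep => j; have [mA _] := inv j; apply: mA.
have [y yP] := choose_family (fun j => proj2 (inv j) (x j)).
exists y; split.
  by split; apply: functional_extensionality_dep => j; have [[]] := yP j.
move=> w [E1 E2]; apply: functional_extensionality_dep => j; have [_] := yP j; apply.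
by split; [exact: (f_equal (fun t => t j) E1) | exact: (f_equal (fun t => t j) E2)].
Qed.

Theorem theorem2p19 (J : Type) (S : J -> Type)
  (op : forall j, set (set (S j))) (m : forall j, S j -> S j -> S j) :
  (exists j : J, True) ->
  (forall j, semitopological_semigroup (op j) (m j)) ->
  (forall j, primitive_inverse_semigroup (m j)) ->
  (forall j, (semiregular (op j) /\ pseudocompact (op j)) \/ countably_compact (op j)) ->
  (forall j (G : set (S j)), maximal_subgroup (m j) G ->
      paratopological_subgroup (op j) (m j) G /\ pseudocompact (sub_open (op j) G)) ->
  let mprod := fun (x y : forall j, S j) => fun j => m j (x j) (y j) in
  pseudocompact (@prod_open J S op) /\
  semitopological_semigroup (@prod_open J S op) mprod /\
  inverse_semigroup mprod.
Proof.
move=> _ sts prim cpt subgroups mprod.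
split; last split.
(* One [p] is fixed before the factors, since the limits in all coordinates must be taken along the
   same ultrafilter. *)
- have [p pu] := free_ultrafilter_exists.
  apply: (ultra_pseudocompact_pseudocompact pu).
  apply: (ultra_pseudocompact_prod pu) => j.
  have [invj [z [zj [_ primj]]]] := prim j.
  apply: (primitive_inverse_ultra_pseudocompact invj zj primj (sts j)) => //.
    case: (cpt j) => [[]//|]; apply: countably_compact_pseudocompact.
    by case: (sts j).
  exact: subgroups.
- exact: prod_semitopological.
- by apply: prod_inverse_semigroup => j; case: (prim j).
Qed.
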